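(* Let $n\ge 2$ and $1\le p<n$. Let $\varphi:[0,\infty)\to[0,\infty)$ be a continuous, strictly increasing function for which there is a constant $C_\varphi$ such that $$\frac{\varphi(t_1)}{t_1}\le C_\varphi\,\frac{\varphi(t_2)}{t_2}\quad\text{whenever } 0<t_1\le t_2 .$$ Suppose that there exists a continuous function $h:[0,\infty)\to[0,\infty)$ such that $$\sum_{k=1}^{\infty}\frac{(2^{-k}t)^n}{\varphi(t2^{-k})^{n-1}}\le h(t)\quad\text{for all } t>0 .$$ Let $\delta:(0,\infty)\to(0,\infty)$ be a continuous function and let $H:[0,\infty)\to[0,\infty)$ be an Orlicz function satisfying the $\Delta_2$-condition. Suppose that there exists a finite constant $C_H$ such that $$H\Big(h(\delta(t))\,t+\varphi(\delta(t))^{1-n}\,(\delta(t))^{n(1-\frac1p)}\Big)\le C_H\,t^p\quad\text{for all } t>0 .$$ Let $G\subset\mathbb{R}^n$ be an open set. If $\|f\|_{L^p(\mathbb{R}^n)}\le 1$, then there exists a constant $C$ such that $$H\left(\int_G\frac{|f(y)|}{\varphi(|x-y|)^{n-1}}\,dy\right)\le C\,(Mf(x))^p$$ for every $x\in\mathbb{R}^n$. Here the constant $C$ depends only on $n$, $p$, $C_\varphi$, $C_H$, and the $\Delta_2$-constant of $H$ (in particular, $C$ is independent of $f$).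
   Context: An Orlicz function is a function $H:[0,\infty)\to[0,\infty)$ such that: (1) $H$ is continuous; (2) $H$ is strictly increasing; (3) $H$ is convex; (4) $\lim_{t\to0^+}H(t)/t=0$ and $\lim_{t\to\infty}H(t)/t=\infty$; (5) $H(t)/t<H(s)/s$ for $0<t<s$. $H$ satisfies the $\Delta_2$-condition if there is a constant $C_H^{\Delta_2}$ (the $\Delta_2$-constant of $H$) with $H(2t)\le C_H^{\Delta_2}H(t)$ for all $t>0$. For a locally integrable function $f$ on $\mathbb{R}^n$, $Mf$ is the Hardy–Littlewood maximal function $Mf(x)=\sup_{r>0}\frac{1}{|B(x,r)|}\int_{B(x,r)}|f(y)|\,dy$, where $B(x,r)$ is the open ball. Values in $[0,\infty]$ are allowed, with $H(\infty)=\infty$. *)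

(* Defs.v *)
From HB Require Import structures.
From mathcomp Require Import all_boot all_order all_algebra.
From mathcomp Require Import all_classical all_reals all_analysis.
From mathcomp Require Import measurable_realfun.

Set Implicit Arguments.
Unset Strict Implicit.
Unset Printing Implicit Defensive.

Import Order.TTheory GRing.Theory Num.Theory.
Import numFieldTopology.Exports numFieldNormedType.Exports.

Local Open Scope classical_set_scope.
Local Open Scope ring_scope.

Definition borel_rV (R : realType) (n : nat) :=
  g_sigma_algebraType (@open 'rV[R]_n).

Section borel_rV.
Context {R : realType}.

Lemma measurable_coord n (i : 'I_n) :
  measurable_fun [set: borel_rV R n]
    (fun v : 'rV[R]_n => v ord0 i : measurableTypeR R).
Proof.
apply: (measurability _ (RGenOpens.measurableE R)).
move=> _ [_ [a [b ->]] <-]; rewrite setTI; apply: sub_sigma_algebra.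
apply: open_comp; last exact: interval_open.
by move=> v _; exact: coord_continuous.
Qed.

Lemma open_bigcup_rat_ball n (A : set 'rV[R]_n) : open A ->
  A = \bigcup_(c in [set c : 'rV[rat]_n * nat |
         ball (map_mx ratr c.1 : 'rV[R]_n) c.2.+1%:R^-1 `<=` A])
      ball (map_mx ratr c.1 : 'rV[R]_n) c.2.+1%:R^-1.
Proof.
move=> oA; apply/seteqP; split; last by move=> v [c /= cA /cA].
move=> v Av.
have /nbhs_ballP[e /= e0 veA] : nbhs v A by exact: open_nbhs_nbhs.
have [m me] : exists m, m.+1%:R^-1 < e / 2.
  have e20 : 0 < e / 2 by rewrite divr_gt0.
  have [m _ /(_ m (leqnn m)) mP] := near_infty_natSinv_lt (PosNum e20).
  by exists m.
have m0 : 0 < m.+1%:R^-1 :> R by rewrite invr_gt0.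
have /choice[q qv] : forall i, exists q : rat,
    `|v ord0 i - ratr q| < m.+1%:R^-1.
  move=> i; have [q] := @rat_in_itvoo R (v ord0 i - m.+1%:R^-1)
    (v ord0 i + m.+1%:R^-1) ltac:(by rewrite ltrBlDr -addrA ltrDl addr_gt0).
  by rewrite in_itv/= -ltr_distl distrC => qP; exists q.
have vq : ball (map_mx ratr (\row_i q i) : 'rV[R]_n) m.+1%:R^-1 v.
  split=> // i j; rewrite ord1 !mxE -ball_normE/= distrC.
  exact: qv.
exists (\row_i q i, m) => //= w qw; apply: veA.
rewrite (splitr e); have le_me := ltW me.
exact: ball_triangle (ball_sym (le_ball le_me vq)) (le_ball le_me qw).
Qed.

Lemma measurable_fun_rV d (T : measurableType d) n (g : T -> 'rV[R]_n) :
  (forall i, measurable_fun [set: T] (fun t => g t ord0 i : measurableTypeR R)) ->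
  measurable_fun [set: T] (g : T -> borel_rV R n).
Proof.
move=> mg; apply: (@measurability _ _ T (borel_rV R n) setT g (@open 'rV[R]_n) erefl).
move=> _ [A oA <-]; rewrite setTI (open_bigcup_rat_ball oA) preimage_bigcup.
rewrite bigcup_mkcond; apply: countable_bigcupT_measurable => // -[c m].
case: ifPn => // _.
rewrite (_ : _ @^-1` _ = \bigcap_(i in [set: 'I_n])
    ((fun t => g t ord0 i) @^-1` ball (ratr (c ord0 i) : R) m.+1%:R^-1)).
  apply: fin_bigcap_measurable => // i _.
  by rewrite -[X in measurable X]setTI; apply: mg => //; exact: measurable_ball.
apply/seteqP; split=> [t [_ gt] i _|t gt].
  by have := gt ord0 i; rewrite mxE.
by split=> [|i j]; rewrite ?invr_gt0 ?ltr0n// ord1 mxE; exact: gt.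
Qed.

Definition cons_rV n (xv : measurableTypeR R * borel_rV R n) :
  borel_rV R n.+1 := row_mx (const_mx xv.1 : 'rV_1) xv.2 : 'rV[R]_(1 + n).

Lemma measurable_cons_rV n : measurable_fun setT (@cons_rV n).
Proof.
apply: measurable_fun_rV => i.
have [j /= ij|j /= ij] := @splitP 1 n i.
  rewrite (_ : i = lshift n j); last exact: val_inj.
  rewrite [X in measurable_fun _ X](_ : _ = fst); first exact: measurable_fst.
  apply/funext => -[x v] /=.
  exact: etrans (row_mxEl (const_mx x : 'rV[R]_1) (v : 'rV[R]_n) _ _)
    (mxE _ _ _ _).
rewrite (_ : i = rshift 1 j); last exact: val_inj.
rewrite [X in measurable_fun _ X](_ : _ =
    (fun v : 'rV[R]_n => v ord0 j) \o snd).
  exact: measurableT_comp (measurable_coord j) measurable_snd.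
apply/funext => -[x v] /=.
exact: (row_mxEr (const_mx x : 'rV[R]_1) (v : 'rV[R]_n)).
Qed.

Definition uncons_rV n (v : 'rV[R]_n.+1) :
    measurableTypeR R * borel_rV R n :=
  (v ord0 ord0, rsubmx (v : 'rV_(1 + n))).

Lemma measurable_uncons_rV n :
  measurable_fun setT (@uncons_rV n : borel_rV R n.+1 -> _).
Proof.
apply: measurable_fun_pair; first exact: measurable_coord.
apply: measurable_fun_rV => i.
rewrite [X in measurable_fun _ X](_ : _ =
    (fun v : 'rV[R]_n.+1 => v ord0 (rshift 1 i))).
  exact: measurable_coord.
by apply/funext => v; rewrite /= mxE.
Qed.

Lemma cons_rVK n : cancel (@cons_rV n) (@uncons_rV n).
Proof.
move=> [x v]; congr pair; last exact: (row_mxKr (const_mx x : 'rV[R]_1)).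
have e0 : ord0 = lshift n (@ord0 0) by exact: val_inj.
exact: etrans (congr1 (row_mx (const_mx x : 'rV_1) v ord0) e0)
  (etrans (row_mxEl (const_mx x : 'rV[R]_1) (v : 'rV[R]_n) _ _) (mxE _ _ _ _)).
Qed.

End borel_rV.

Section lebesgue_step.
Context {R : realType} (n : nat).
Variable m : {sigma_finite_measure set (borel_rV R n) -> \bar R}.
Local Open Scope ereal_scope.

Definition lebesgue_cons : set (borel_rV R n.+1) -> \bar R :=
  pushforward (lebesgue_measure \x m) (@cons_rV R n).

Let lebesgue_cons0 : lebesgue_cons set0 = 0.
Proof. by rewrite /lebesgue_cons /pushforward preimage_set0 measure0. Qed.

Let lebesgue_cons_ge0 A : 0 <= lebesgue_cons A.
Proof. exact: (measure_ge0 (lebesgue_measure \x m)). Qed.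

Let lebesgue_cons_sigma_additive : semi_sigma_additive lebesgue_cons.
Proof.
move=> F mF tF mUF; rewrite /lebesgue_cons /pushforward preimage_bigcup.
apply: measure_semi_sigma_additive.
- by move=> k; rewrite -[X in measurable X]setTI; exact: measurable_cons_rV.
- apply/trivIsetP => /= i j _ _ ij; rewrite -preimage_setI.
  by move/trivIsetP : tF => /(_ _ _ _ _ ij) ->//; rewrite preimage_set0.
- rewrite -preimage_bigcup -[X in measurable X]setTI.
  exact: measurable_cons_rV.
Qed.

HB.instance Definition _ := isMeasure.Build _ _ _ lebesgue_cons
  lebesgue_cons0 lebesgue_cons_ge0 lebesgue_cons_sigma_additive.

Let lebesgue_cons_sigma_finite : sigma_finite setT lebesgue_cons.
Proof.
have /sigma_finiteP[F [FT ndF Foo]] := sigma_finiteT (@lebesgue_measure R).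
have /sigma_finiteP[G [GT ndG Goo]] := sigma_finiteT m.
exists (fun k => @uncons_rV R n @^-1` (F k `*` G k)).
  rewrite -preimage_bigcup (_ : \bigcup_i _ = setT) ?preimage_setT//.
  apply/seteqP; split=> // -[x v] _.
  have : [set: measurableTypeR R] x by [].
  have : [set: borel_rV R n] v by [].
  rewrite FT GT => -[j _ Gv] [i _ Fx]; exists (maxn i j) => //; split=> /=.
    by move: Fx; exact/subsetPset/ndF/leq_maxl.
  by move: Gv; exact/subsetPset/ndG/leq_maxr.
move=> k; have [mF Fk] := Foo k; have [mG Gk] := Goo k; split.
  rewrite -[X in measurable X]setTI; apply: measurable_uncons_rV => //.
  exact: measurableX.
rewrite /lebesgue_cons /pushforward -comp_preimage.
rewrite (_ : _ \o _ = id); last by apply/funext => xv; exact: cons_rVK.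
by rewrite preimage_id product_measure1E// lte_mul_pinfty// ge0_fin_numE.
Qed.

HB.instance Definition _ := Measure_isSigmaFinite.Build _ _ _ lebesgue_cons
  lebesgue_cons_sigma_finite.

End lebesgue_step.

(* Lebesgue measure on the Borel sets: the n-fold product of lebesgue_measure,
   carried to row vectors by cons_rV. *)
Fixpoint lebesgue_borel (R : realType) (n : nat) :
    {sigma_finite_measure set (borel_rV R n) -> \bar R} :=
  if n is n'.+1 then lebesgue_cons (lebesgue_borel R n')
  else @dirac _ (borel_rV R 0) (0 : 'rV[R]_0) R.

Lemma lebesgue_borel_box (R : realType) (n : nat)
    (A : 'I_n -> set (measurableTypeR R)) : (forall i, measurable (A i)) ->
  (lebesgue_borel R n [set v : 'rV[R]_n | forall i, A i (v ord0 i)] =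
   \prod_i lebesgue_measure (A i))%E.
Proof.
elim: n A => [|n IHn] A mA.
  by rewrite big_ord0 /= diracE mem_set// => -[].
rewrite big_ord_recl -IHn// /= /lebesgue_cons /pushforward.
have mbox : measurable ([set v : 'rV[R]_n |
    forall i, A (lift ord0 i) (v ord0 i)] : set (borel_rV R n)).
  rewrite (_ : [set v : 'rV[R]_n | _] = \bigcap_(i in [set: 'I_n])
      ((fun v : 'rV[R]_n => v ord0 i) @^-1` A (lift ord0 i))).
    apply: fin_bigcap_measurable => // i _.
    by rewrite -[X in measurable X]setTI; exact: measurable_coord.
  by apply/seteqP; split=> [v Av i _|v Av i]; exact: Av.
rewrite -product_measure1E//; congr (_ _).
have cons0 (x : R) (v : 'rV[R]_n) : (cons_rV (x, v) : 'rV[R]_n.+1) ord0 ord0 = x.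
  by have /(congr1 fst) := cons_rVK (x, v).
have consS (x : R) (v : 'rV[R]_n) i :
    (cons_rV (x, v) : 'rV[R]_n.+1) ord0 (lift ord0 i) = v ord0 i.
  have /(congr1 snd)/= /rowP/(_ i) <- := cons_rVK (x, v).
  rewrite [RHS]mxE; congr (fun_of_matrix _ _ _); exact: val_inj.
apply/seteqP; split=> [[x v] /= Axv|[x v] /= [Ax Av] i].
  split=> [|i]; first by rewrite -[x](cons0 x v); exact: Axv.
  by rewrite -(consS x v); exact: Axv.
have [j ->|->] := unliftP ord0 i; last by rewrite cons0.
by rewrite consS; exact: Av.
Qed.

(* 'rV[R]_n with the Lebesgue measurable sets, that is the Caratheodory
   sigma-algebra of the outer measure of lebesgue_borel. *)
Definition Rn (R : realType) (n : nat) :=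
  caratheodory_type (mu_ext (lebesgue_borel R n)).

Definition lebesgue_rV (R : realType) (n : nat) : set (Rn R n) -> \bar R :=
  @completed_measure_extension _ _ _ (lebesgue_borel R n).
Arguments lebesgue_rV : clear implicits.
HB.instance Definition _ (R : realType) (n : nat) :=
  Measure.on (lebesgue_rV R n).

Lemma lebesgue_rVE (R : realType) (n : nat) (A : set (borel_rV R n)) :
  measurable A -> lebesgue_rV R n A = lebesgue_borel R n A.
Proof. exact: measurable_mu_extE. Qed.

Section euclidean.
Context {R : realType} {n : nat}.
Implicit Types (x y : 'rV[R]_n) (f : 'rV[R]_n -> R).

(* The library norm on 'rV[R]_n is the sup norm. *)
Definition enorm x : R := Num.sqrt (\sum_i x ord0 i ^+ 2).

Definition eball x (r : R) : set 'rV[R]_n := [set y | enorm (x - y) < r].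

Definition maximal f x : \bar R :=
  ereal_sup [set ((lebesgue_rV R n (eball x r))^-1 *
                  \int[lebesgue_rV R n]_(y in eball x r) `|f y|%:E)%E
            | r in `]0, +oo[].

End euclidean.

Record orlicz (R : realType) (H : R -> R) : Prop := Orlicz {
  orlicz_ge0 : forall t, 0 <= t -> 0 <= H t ;
  orlicz_continuous : {within `[0, +oo[, continuous H} ;
  orlicz_increasing : {in `[0, +oo[ &, {homo H : s t / s < t}} ;
  orlicz_convex : convex_function (`[0, +oo[%classic : set R) H ;
  orlicz_cvg0 : H t / t @[t --> 0^'+] --> (0 : R) ;
  orlicz_cvgy : H t / t @[t --> +oo] --> +oo ;
  orlicz_div_increasing :
    forall t s, 0 < t -> t < s -> H t / t < H s / s
}.

Definition delta2 (R : realType) (H : R -> R) (K : R) : Prop :=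
  forall t, 0 < t -> H (2 * t) <= K * H t.

(* Main.v *)
Require Import Defs.
From HB Require Import structures.
From mathcomp Require Import all_boot all_order all_algebra.
From mathcomp Require Import all_classical all_reals all_analysis.
From mathcomp Require Import measurable_realfun.
From mathcomp Require Import lra ring.

Set Implicit Arguments.
Unset Strict Implicit.
Unset Printing Implicit Defensive.

Import Order.TTheory GRing.Theory Num.Theory.
Import numFieldTopology.Exports numFieldNormedType.Exports.

Local Open Scope classical_set_scope.
Local Open Scope ring_scope.

(** The proof is Hedberg's argument. Write [t] for the maximal function of [f]
at [x] and split the potential at a radius [r] around [x].

Inside the ball of radius [r], decompose into dyadic annuli. On each of them the
kernel is at most its value on the inner sphere, and the integral of [`|f|] is at
most the volume of the outer ball times [t]. The sum over the annuli is the
series that [h] bounds, so this part is at most a constant times [h r * t]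
([potential_near_le]).

Outside, decompose again. Now the integral of [`|f|] over a ball is estimated
with the norm of [f] ([integral_le_Lnorm]), and the kernel with the almost
monotonicity of [phi t / t]. As [p < n] the terms form a convergent geometric
series, comparable to its first term [phi r ^- n.-1 * r `^ (n * (1 - p^-1))]
([potential_far_le]).

With [r = delta t] the sum of the two bounds is the argument of [H] in the
hypothesis, up to a constant that depends on [n], [p] and [Cphi] only. Since [H]
is doubling, the constant can be taken out of [H] ([delta2_iter]), and the
hypothesis on [delta] concludes. This needs [0 < t < +oo]. If [t = +oo] the
claim is trivial, and if [t = 0] the potential vanishes ([potential_eq0]) and so
does [H 0] ([orlicz0]). *)

(** * Sequences and powers of real numbers *)

(** Used to locate a point in a dyadic annulus: [P k] says that it lies on one
side of the [k]-th sphere. *)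
Lemma exists_last_step (P : nat -> bool) m : P 0%N -> ~~ P m ->
  exists2 k, P k & ~~ P k.+1.
Proof.
elim: m => [->//|m IHm] P0 Pm.
by have [Pk|/(IHm P0)] := boolP (P m); first by exists m.
Qed.

Lemma exists_expr2_gt (R : realType) (x : R) : exists m, x < 2 ^+ m.
Proof.
exists (Num.truncn x).+1; apply: (lt_le_trans (truncnS_gt x)).
by rewrite -natrX ler_nat ltnW// ltn_expl.
Qed.

Lemma nneseries_geometric_le (R : realType) (c q : R) : 0 <= c -> 0 < q -> q < 1 ->
  (\sum_(k <oo) (c * q ^+ k)%:E <= (c / (1 - q))%:E)%E.
Proof.
move=> c0 q0 q1; apply: lime_le.
  by apply: is_cvg_nneseries => k _ _; rewrite lee_fin mulr_ge0// exprn_ge0// ltW.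
near=> m; rewrite sumEFin lee_fin.
by apply: (geometric_le_lim m c0 q0); rewrite gtr0_norm.
Unshelve. all: by end_near. Qed.

(** A substitute for Hoelder's inequality with a free threshold [l]: if [a <= l]
the first term suffices, and otherwise [a = a * 1 <= a * (a / l) `^ (p - 1)].
Unlike Hoelder's inequality it treats [p = 1] and [1 < p] alike. *)
Lemma le_young_powR (R : realType) (p a l : R) : 1 <= p -> 0 <= a -> 0 < l ->
  a <= l + l `^ (1 - p) * a `^ p.
Proof.
move=> p1 a0 l0; have [al|la] := lerP a l.
  by rewrite (le_trans al)// lerDl mulr_ge0// powR_ge0.
have ap : 0 < a by exact: lt_trans la.
rewrite ler_wpDl ?(ltW l0)//.
rewrite -(@mulr_powRB1 _ a p a0) ?(lt_le_trans ltr01 p1)//.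
rewrite mulrCA ler_peMr// -opprB powRN ler_pdivlMl ?powR_gt0//.
by rewrite mulr1 ge0_ler_powR ?subr_ge0// ?nnegrE ?(ltW l0)// ltW.
Qed.

(** * Integral estimates in a measure space *)

Section measure_space.
Context d (T : measurableType d) (R : realType).
Variable mu : {measure set T -> \bar R}.
Local Open Scope ereal_scope.

(** Countable subadditivity for a weight that is frozen on each piece: almost
every point of [D] lies in some [A k] on which [F <= a k * g], so that
[F <= \sum_k a k * g * \1_(A k)] almost everywhere; integrate termwise. The
[A k] may overlap, which lets balls replace annuli. *)
Lemma integral_le_series_cover (D N : set T) (A : nat -> set T)
    (a : nat -> R) (F g : T -> \bar R) :
  measurable D -> measurable N -> mu N = 0 ->
  (forall k, measurable (A k)) -> (forall k, (0 <= a k)%R) ->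
  measurable_fun D F -> (forall y, D y -> 0 <= F y) ->
  measurable_fun setT g -> (forall y, 0 <= g y) ->
  (forall y, D y -> ~ N y -> exists2 k, A k y & F y <= (a k)%:E * g y) ->
  \int[mu]_(y in D) F y <= \sum_(k <oo) (a k)%:E * \int[mu]_(y in A k) g y.
Proof.
move=> mD mN N0 mA a0 mF F0 mg g0 cover.
have gA0 k y : 0 <= (g \_ (A k)) y by rewrite patchE; case: ifPn.
have mgA k : measurable_fun D (g \_ (A k)).
  apply/measurable_restrict => //.
  by apply: measurable_funS mg => //.
have maA k : measurable_fun D (fun y => (a k)%:E * (g \_ (A k)) y).
  exact: measurable_funeM.
have aA0 k y : 0 <= (a k)%:E * (g \_ (A k)) y by rewrite mule_ge0// lee_fin.
apply: (@le_trans _ _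
    (\int[mu]_(y in D) \sum_(k <oo) (a k)%:E * (g \_ (A k)) y)).
  apply: ae_ge0_le_integral => //.
  - by move=> y _; apply: nneseries_ge0 => k _ _; exact: aA0.
  - exact: ge0_emeasurable_sum.
  - exists N; split => // y /= /not_implyP[Dy] Fy; apply: contrapT => Ny.
    have [k Aky Fk] := cover _ Dy Ny; apply: Fy; apply: (le_trans Fk).
    rewrite (_ : (a k)%:E * g y = (a k)%:E * (g \_ (A k)) y); last first.
      by rewrite patchE mem_set.
    rewrite (nneseriesD1 (n := k))//.
    by rewrite leeDl//; apply: nneseries_ge0 => *; exact: aA0.
rewrite integral_nneseries//; apply: lee_nneseries => [k _ _|k _].
  by apply: integral_ge0 => y _; exact: aA0.
rewrite ge0_integralZl_EFin//; apply: lee_wpmul2l; first by rewrite lee_fin.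
rewrite -integral_mkcondr; apply: ge0_subset_integral => //.
  exact: measurableI.
exact: measurable_funS mg.
Qed.

(** Hoelder's inequality on a set of measure at most [v], up to the factor 2:
integrate [le_young_powR] over [B]. The threshold [l = v `^ (- p^-1)] balances
the two terms [l * v] and [l `^ (1 - p)]. *)
Lemma integral_le_Lnorm (p v : R) (f : T -> R) (B : set T) :
  (1 <= p)%R -> (0 < v)%R -> measurable B -> mu B <= v%:E ->
  measurable_fun setT f -> 'N[mu]_p%:E[EFin \o f] <= 1 ->
  \int[mu]_(y in B) `|f y|%:E <= (2 * v `^ (1 - p^-1))%:E.
Proof.
move=> p1 v0 mB Bv mf fp.
have p0 : (0 < p)%R by exact: lt_le_trans p1.
have fp1 : \int[mu]_y (`|f y| `^ p)%:E <= 1.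
  rewrite (_ : \int[mu]_y _ = 'N[mu]_p%:E[EFin \o f] `^ p); last first.
    by rewrite poweR_Lnorm ?gt_eqF//; apply: eq_integral => y _ /=; rewrite poweR_EFin.
  rewrite -(poweR1r p); apply: gt0_ler_poweR => //; rewrite ?(ltW p0)//.
    by rewrite in_itv/= leey Lnorm_ge0.
  by rewrite in_itv/= leey lee01.
have mabs : measurable_fun setT (fun y => (`|f y|)%R).
  exact: measurableT_comp.
have mp : measurable_fun setT (fun y => (`|f y| `^ p)%R).
  exact: measurableT_comp (measurable_powR p) mabs.
pose l := (v `^ (- p^-1))%R.
have l0 : (0 < l)%R by exact: powR_gt0.
apply: (@le_trans _ _ (\int[mu]_(y in B) (l%:E + (l `^ (1 - p))%:E * (`|f y| `^ p)%:E))).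
  apply: ge0_le_integral => //.
  - by apply/measurable_EFinP; exact: measurable_funS mabs.
  - apply: emeasurable_funD => //; apply: measurable_funeM.
    by apply/measurable_EFinP; exact: measurable_funS mp.
  - by move=> y _; rewrite -EFinM -EFinD lee_fin; exact: le_young_powR.
have mpB : measurable_fun B (fun y => (`|f y| `^ p)%:E).
  by apply/measurable_EFinP; exact: measurable_funS mp.
rewrite ge0_integralD//; first last.
- exact: measurable_funeM.
- by move=> y _; rewrite -EFinM lee_fin mulr_ge0 ?powR_ge0.
- by move=> y _; rewrite lee_fin ltW.
rewrite integral_cst// ge0_integralZl_EFin//; last exact: powR_ge0.
rewrite (_ : (2 * _)%R = (l * v + l `^ (1 - p) * 1)%R); last first.
  rewrite mulr1 -powRrM mulr_natl mulr2n; congr (_ + _)%R.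
    rewrite /l -[X in (_ * X)%R](powRr1 (ltW v0)) -powRD ?(gt_eqF v0) ?implybT//.
    by rewrite addrC.
  by congr (_ `^ _)%R; rewrite mulrBr mulr1 mulNr opprK mulVf ?gt_eqF// addrC.
rewrite EFinD !EFinM; apply: leeD; apply: lee_wpmul2l; rewrite ?lee_fin ?(ltW l0) ?powR_ge0//.
apply: le_trans fp1; apply: ge0_subset_integral => //.
by apply/measurable_EFinP.
Qed.

End measure_space.

(** * Dyadic decomposition of a radial potential *)

Section riesz.
Context d (T : measurableType d) (R : realType).
Variable mu : {measure set T -> \bar R}.
Variables (rho : T -> R) (w : R -> R) (f : T -> R).
Hypothesis mrho : measurable_fun setT rho.
Hypothesis rho_ge0 : forall y, 0 <= rho y.
Hypothesis rho0 : mu [set y | rho y = 0] = 0%E.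
Hypothesis w_ge0 : forall r, 0 <= r -> 0 <= w r.
Hypothesis w_noninc : forall r s, 0 < r -> r <= s -> w s <= w r.
Hypothesis mf : measurable_fun setT f.

Let lev r : set T := [set y | rho y < r].

Lemma measurable_lev r : measurable (lev r).
Proof.
rewrite /lev -[X in measurable X]setTI.
rewrite (_ : [set _ | _] = rho @^-1` `]-oo, r[).
  exact: mrho.
by apply/seteqP; split => y /=; rewrite in_itv.
Qed.

Lemma measurable_rho0 : measurable [set y | rho y = 0].
Proof. by rewrite -[X in measurable X]setTI; exact: (mrho _ (measurable_set1 0)). Qed.

Local Open Scope ereal_scope.

(** Dyadic decomposition towards the centre. On the annulus
[2 ^- k.+1 * t <= rho y < 2 ^- k * t] the nonincreasing weight is at most its
value on the inner sphere. The point where [rho] vanishes belongs to no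
annulus; it is discarded as a null set. *)
Lemma riesz_near (D : set T) (t : R) : (0 < t)%R -> measurable D -> D `<=` lev t ->
  measurable_fun D (fun y => w (rho y)) ->
  \int[mu]_(y in D) (`|f y| * w (rho y))%:E <=
  \sum_(k <oo) (w (2 ^- k.+1 * t)%R)%:E *
    \int[mu]_(y in lev (2 ^- k * t)%R) `|f y|%:E.
Proof.
move=> t0 mD Dt mw.
apply: (integral_le_series_cover mD measurable_rho0 rho0) => //.
- by move=> k; exact: measurable_lev.
- by move=> k; rewrite w_ge0// mulr_ge0 ?invr_ge0 ?exprn_ge0// ltW.
- apply/measurable_EFinP; apply: measurable_funM => //.
  by apply: measurable_funS (measurableT_comp _ mf) => //.
- by move=> y _; rewrite lee_fin mulr_ge0// w_ge0.
- by apply/measurable_EFinP; exact: measurableT_comp.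
move=> y Dy /eqP ry; have rp : (0 < rho y)%R by rewrite lt0r ry rho_ge0.
have [m tm] := exists_expr2_gt (t / rho y).
have [||k kl ku] := @exists_last_step (fun k => rho y < 2 ^- k * t)%R m.
- by rewrite expr0 invr1 mul1r; exact: Dt.
- by rewrite -leNgt mulrC ler_pdivrMr ?exprn_gt0// mulrC -ler_pdivrMr// ltW.
exists k => //.
rewrite -EFinM lee_fin mulrC ler_wpM2r// w_noninc// ?leNgt//.
by rewrite mulr_gt0// invr_gt0 exprn_gt0.
Qed.

(** Dyadic decomposition towards infinity, again with the weight evaluated on
the inner sphere of each annulus. *)
Lemma riesz_far (D : set T) (t : R) : (0 < t)%R -> measurable D ->
  (forall y, D y -> (t <= rho y)%R) ->
  measurable_fun D (fun y => w (rho y)) ->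
  \int[mu]_(y in D) (`|f y| * w (rho y))%:E <=
  \sum_(k <oo) (w (2 ^+ k * t)%R)%:E *
    \int[mu]_(y in lev (2 ^+ k.+1 * t)%R) `|f y|%:E.
Proof.
move=> t0 mD Dt mw.
apply: (integral_le_series_cover mD measurable_rho0 rho0) => //.
- by move=> k; exact: measurable_lev.
- by move=> k; rewrite w_ge0// mulr_ge0 ?invr_ge0 ?exprn_ge0// ltW.
- apply/measurable_EFinP; apply: measurable_funM => //.
  by apply: measurable_funS (measurableT_comp _ mf) => //.
- by move=> y _; rewrite lee_fin mulr_ge0// w_ge0.
- by apply/measurable_EFinP; exact: measurableT_comp.
move=> y Dy _.
have [m tm] := exists_expr2_gt (rho y / t).
have [||k kl ku] := @exists_last_step (fun k => 2 ^+ k * t <= rho y)%R m.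
- by rewrite expr0 mul1r; exact: Dt.
- by rewrite -ltNge -ltr_pdivrMr.
exists k; first by rewrite /lev/= ltNge.
rewrite -EFinM lee_fin mulrC ler_wpM2r// w_noninc//.
by rewrite mulr_gt0// exprn_gt0.
Qed.

End riesz.

(** * Euclidean balls and the maximal function *)

Section euclidean_measure.
Variables (R : realType) (n : nat).
Implicit Types x y : 'rV[R]_n.

Lemma borel_measurable_Rn (A : set 'rV[R]_n) :
  measurable (A : set (borel_rV R n)) -> measurable (A : set (Rn R n)).
Proof.
by move=> mA; apply: (sub_caratheodory (lebesgue_borel R n)); exact: sub_sigma_algebra.
Qed.

Lemma open_measurable_Rn (A : set 'rV[R]_n) :
  open A -> measurable (A : set (Rn R n)).
Proof. by move=> oA; apply: borel_measurable_Rn; exact: sub_sigma_algebra. Qed.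

Lemma borel_measurable_fun_Rn (g : 'rV[R]_n -> R) :
  measurable_fun [set: borel_rV R n] g -> measurable_fun [set: Rn R n] g.
Proof.
move=> mg _ A mA; apply: borel_measurable_Rn.
by have := mg measurableT A mA.
Qed.

Lemma enorm_ge0 x : 0 <= enorm x. Proof. exact: sqrtr_ge0. Qed.

Lemma coord_le_enorm x i : `|x ord0 i| <= enorm x.
Proof.
rewrite -sqrtr_sqr ler_wsqrtr// (bigD1 i)//= lerDl.
by apply: sumr_ge0 => j _; exact: sqr_ge0.
Qed.

Lemma measurable_enormB x : measurable_fun [set: Rn R n] (fun y => enorm (x - y)).
Proof.
apply: borel_measurable_fun_Rn.
have msqrt : measurable_fun setT (@Num.sqrt R).
  by apply: nondecreasing_measurable => // a b ab; exact: ler_wsqrtr.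
have msum : measurable_fun [set: borel_rV R n]
    (fun y : 'rV[R]_n => \sum_i (x ord0 i - y ord0 i) ^+ 2).
  apply: (@measurable_sum _ (borel_rV R n) R setT _ (index_enum 'I_n)
    (fun i (y : 'rV[R]_n) => (x ord0 i - y ord0 i) ^+ 2)) => i.
  apply: measurable_funX; apply: measurable_funB => //.
  exact: measurable_coord.
rewrite [X in measurable_fun _ X](_ : _ = Num.sqrt \o
    (fun y : 'rV[R]_n => \sum_i (x ord0 i - y ord0 i) ^+ 2)).
  exact: measurableT_comp msqrt msum.
by apply/funext => y /=; congr Num.sqrt; apply: eq_bigr => i _; rewrite !mxE.
Qed.

Lemma measurable_eball x r : measurable (eball x r : set (Rn R n)).
Proof. exact: (measurable_lev (measurable_enormB x)). Qed.

(** The ball lies in a cube of side [2 * r]. Only an upper bound on the volume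
is ever used, so the exact constant of the unit ball does not enter. *)
Lemma eball_volume_le x (r : R) : 0 < r ->
  (lebesgue_rV R n (eball x r) <= ((2 * r) ^+ n)%:E)%E.
Proof.
move=> r0.
pose A i : set (measurableTypeR R) := `]x ord0 i - r, x ord0 i + r[%classic.
have mA i : measurable (A i) by exact: measurable_itv.
pose B : set (borel_rV R n) := [set v : 'rV[R]_n | forall i, A i (v ord0 i)].
have mB : measurable B.
  rewrite (_ : B = \bigcap_(i in [set: 'I_n])
      ((fun v : 'rV[R]_n => v ord0 i) @^-1` A i)).
    apply: fin_bigcap_measurable => // i _.
    by rewrite -[X in measurable X]setTI; exact: measurable_coord.
  by apply/seteqP; split=> [v Av i _|v Av i]; exact: Av.
apply: (@le_trans _ _ (lebesgue_rV R n B)).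
  apply: le_measure; rewrite ?inE.
  - exact: measurable_eball.
  - exact: borel_measurable_Rn.
  - move=> y xy i; rewrite /A/= in_itv/= -ltr_distl distrC.
    by have := le_lt_trans (coord_le_enorm (x - y) i) xy; rewrite !mxE.
rewrite lebesgue_rVE// lebesgue_borel_box//.
rewrite (eq_bigr (fun=> (2 * r)%:E)); last first.
  move=> i _; rewrite lebesgue_measure_itv/= lte_fin ltrBlDr -addrA ltrDl addr_gt0//.
  by rewrite -EFinB opprB addrC addrA subrK mulr_natl mulr2n.
by rewrite prodEFin prodr_const card_ord.
Qed.

(** This set is contained in every ball around [x], and [(2 * r) ^+ n] tends to 0
with [r] because [0 < n]. *)
Lemma enormB0_null x : (0 < n)%N ->
  lebesgue_rV R n [set y | enorm (x - y) = 0] = 0%E.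
Proof.
move=> n0; apply/eqP; rewrite eq_le measure_ge0 andbT.
apply/lee_addgt0Pr => e e0; rewrite add0e.
pose r := Num.min 1 e / 2.
have m0 : 0 < Num.min 1 e by rewrite lt_min ltr01 e0.
have r0 : 0 < r by rewrite divr_gt0.
have rE : 2 * r = Num.min 1 e by rewrite /r mulrC divfK.
apply: (@le_trans _ _ (lebesgue_rV R n (eball x r))).
  apply: le_measure; rewrite ?inE.
  - exact: (measurable_rho0 (measurable_enormB x)).
  - exact: measurable_eball.
  - by move=> y /= xy; rewrite /eball/= xy.
apply: (le_trans (eball_volume_le x r0)).
rewrite rE lee_fin -(prednK n0) exprS.
apply: (@le_trans _ _ (Num.min 1 e)); last by rewrite ge_min lexx orbT.
by rewrite ler_piMr ?(ltW m0)// exprn_ile1 ?(ltW m0)// ge_min lexx.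
Qed.

Lemma maximal_ge0 (f : 'rV[R]_n -> R) x :
  (0 <= maximal f x)%E.
Proof.
pose I := ((lebesgue_rV R n (eball x 1))^-1 *
  \int[lebesgue_rV R n]_(y in eball x 1) `|f y|%:E)%E.
apply: (@le_trans _ _ I); last first.
  by apply: ereal_sup_ubound; exists 1; rewrite //= in_itv/= ltr01.
by rewrite mule_ge0 ?inve_ge0 ?measure_ge0// integral_ge0.
Qed.

(** The average over the ball is at most [t], so the integral is at most [t]
times the volume. The quotient in [maximal] says nothing on a ball of measure
0, but there the integral vanishes anyway. *)
Lemma integral_eball_le_maximal (f : 'rV[R]_n -> R) x (t r : R) :
  measurable_fun [set: Rn R n] f -> 0 < r -> 0 <= t ->
  (maximal f x <= t%:E)%E ->
  (\int[lebesgue_rV R n]_(y in eball x r) `|f y|%:E <= ((2 * r) ^+ n * t)%:E)%E.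
Proof.
move=> mf r0 t0 Mt.
have mabs : measurable_fun (eball x r : set (Rn R n)) (fun y => `|f y|%:E).
  apply/measurable_EFinP; apply: measurable_funS (measurableT_comp _ mf) => //.
have mB := measurable_eball x r.
have vol := eball_volume_le x r0.
have [B0|B0] := eqVneq (lebesgue_rV R n (eball x r)) 0%E.
  rewrite null_set_integral// lee_fin mulr_ge0// exprn_ge0// mulr_ge0// ltW//.
have Bfin : lebesgue_rV R n (eball x r) \is a fin_num.
  by rewrite ge0_fin_numE// (le_lt_trans vol) ?ltry.
have : ((lebesgue_rV R n (eball x r))^-1 *
    \int[lebesgue_rV R n]_(y in eball x r) `|f y|%:E <= t%:E)%E.
  by apply: le_trans Mt; apply: ereal_sup_ubound; exists r; rewrite //= in_itv/= r0.
have Bge0 : (0 <= lebesgue_rV R n (eball x r))%E by exact: measure_ge0.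
move=> /(lee_wpmul2l Bge0).
rewrite muleA divee// mul1e => /le_trans; apply.
by rewrite EFinM lee_wpmul2r// lee_fin.
Qed.

End euclidean_measure.

(** * Estimates of the potential *)

(** With [s = n * (1 - p^-1)], this is the sum of the geometric series of ratio
[2 `^ s / 2 ^+ n.-1] that dominates the contributions of the far annuli, once
the factor [phi r ^- n.-1 * r `^ s] is taken out. *)
Definition far_const (R : realType) (n : nat) (p C : R) : R :=
  let s := n%:R * (1 - p^-1) in
  2 * 4 `^ s * C ^+ n.-1 / (1 - 2 `^ s / 2 ^+ n.-1).

Section potential_estimates.
Variables (R : realType) (n : nat) (phi : R -> R).
Hypothesis n_gt1 : (2 <= n)%N.
Hypothesis phi_ge0 : forall t, 0 <= t -> 0 <= phi t.
Hypothesis phi_incr : {in `[0, +oo[ &, {homo phi : s t / s < t}}.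
Variables (f : 'rV[R]_n -> R) (x : 'rV[R]_n).
Hypothesis mf : measurable_fun [set: Rn R n] f.

Let mu := lebesgue_rV R n.
Let w (r : R) := phi r ^- n.-1.

Lemma incr_gt0 t : 0 < t -> 0 < phi t.
Proof.
move=> t0; apply: (le_lt_trans (phi_ge0 (lexx 0))).
by apply: phi_incr => //; rewrite in_itv/= ?lexx ?(ltW t0).
Qed.

Lemma incr_le s t : 0 <= s -> s <= t -> phi s <= phi t.
Proof.
move=> s0; rewrite le_eqVlt => /predU1P[->//|st].
by apply/ltW/phi_incr => //; rewrite in_itv/= ?s0 ?(le_trans s0 (ltW st)).
Qed.

Let w_ge0 r : 0 <= r -> 0 <= w r.
Proof. by move=> r0; rewrite invr_ge0 exprn_ge0// phi_ge0. Qed.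

Let w_noninc r s : 0 < r -> r <= s -> w s <= w r.
Proof.
move=> r0 rs; have s0 : 0 < s by exact: lt_le_trans rs.
rewrite lef_pV2 ?posrE ?exprn_gt0 ?incr_gt0// lerXn2r ?nnegrE ?phi_ge0 ?(ltW r0) ?(ltW s0)//.
by rewrite incr_le// ltW.
Qed.

Let rho0 : mu [set y | enorm (x - y) = 0] = 0%E.
Proof. by apply: enormB0_null; exact: leq_trans n_gt1. Qed.

(** A monotone function is measurable; [phi] is monotone only on the nonnegative
half-line, hence the detour through [Num.max 0]. *)
Lemma measurable_kernel_weight (D : set (Rn R n)) :
  measurable_fun D (fun y => phi (enorm (x - y)) ^- n.-1).
Proof.
have mphi : measurable_fun setT (fun r : R => phi (Num.max 0 r)).
  apply: nondecreasing_measurable => // a b ab; apply: incr_le.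
    by rewrite le_max lexx.
  by rewrite ge_max le_max lexx le_max ab orbT.
apply: (@measurable_funS _ _ _ _ setT) => //.
rewrite [X in measurable_fun _ X](_ : _ = (fun r : R => r `^ (-1)) \o
    ((fun r : R => phi (Num.max 0 r) ^+ n.-1) \o (fun y => enorm (x - y)))).
  apply: measurableT_comp (measurable_powR _) _.
  apply: measurableT_comp (measurable_enormB x).
  exact: measurable_funX.
apply/funext => y /=.
by rewrite (max_idPr (enorm_ge0 _)) powR_inv1// exprn_ge0// phi_ge0// enorm_ge0.
Qed.

(** In each annulus the integral of [`|f|] is at most volume times [t], and the
resulting series is the one that defines the bound [h], up to [4 ^+ n]: one
factor [2 ^+ n] is the volume of the cube around the unit ball, the other one
comes from the radius [2 ^- k] of a ball against the argument [2 ^- k.+1] of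
[phi]. *)
Lemma potential_near_le (h : R -> R) (t r : R) (D : set (Rn R n)) :
  (forall r, 0 < r -> (\sum_(1 <= k <oo)
     ((2 ^- k * r) ^+ n / phi (r * 2 ^- k) ^+ n.-1)%:E <= (h r)%:E)%E) ->
  0 < r -> 0 <= t -> (maximal f x <= t%:E)%E ->
  measurable D -> D `<=` eball x r ->
  (\int[mu]_(y in D) (`|f y| / phi (enorm (x - y)) ^+ n.-1)%:E <=
     (4 ^+ n * (h r * t))%:E)%E.
Proof.
move=> hsum r0 t0 Mt mD Dr.
apply: (le_trans (riesz_near (measurable_enormB x) (fun y => enorm_ge0 _) rho0
  w_ge0 w_noninc mf r0 mD Dr (@measurable_kernel_weight D))).
pose u k := ((2 ^- k * r) ^+ n / phi (r * 2 ^- k) ^+ n.-1)%:E.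
have lev0 k : 0 < 2 ^- k * r by rewrite mulr_gt0// invr_gt0 exprn_gt0.
have u0 k : (0 <= u k)%E.
  by rewrite lee_fin divr_ge0 ?exprn_ge0 ?phi_ge0 ?(ltW (lev0 _))// mulrC ltW.
apply: (@le_trans _ _ (\sum_(k <oo) (4 ^+ n * t)%:E * u (k + 1)%N)%E).
  apply: lee_nneseries => [k _ _|k _].
    by rewrite mule_ge0 ?lee_fin ?w_ge0 ?(ltW (lev0 _))// integral_ge0.
  apply: (@le_trans _ _ ((w (2 ^- k.+1 * r))%:E *
      ((2 * (2 ^- k * r)) ^+ n * t)%:E)%E).
    apply: lee_wpmul2l; first by rewrite lee_fin w_ge0// ltW.
    exact: integral_eball_le_maximal.
  rewrite -!EFinM lee_fin addn1.
  have -> : 2 * (2 ^- k * r) = 4 * (2 ^- k.+1 * r).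
    rewrite exprS invfM !mulrA; congr (_ * _ * _); lra.
  rewrite exprMn /w (mulrC r) le_eqVlt; apply/orP; left; apply/eqP.
  ring.
rewrite nneseriesZl; last by move=> k _; exact: u0.
rewrite (nneseries_addn (f := u) 1)//.
rewrite (_ : 4 ^+ n * (h r * t) = 4 ^+ n * t * h r); last by ring.
rewrite (EFinM _ (h r)); apply: lee_wpmul2l; last exact: hsum.
by rewrite lee_fin mulr_ge0// exprn_ge0.
Qed.

(** In the annulus of radius [2 ^+ k * r] the integral of [`|f|] is at most a
multiple of [(2 ^+ k * r) `^ s] with [s = n * (1 - p^-1)], by
[integral_le_Lnorm], while the almost monotonicity of [phi t / t] makes the
kernel decay at least like [(2 ^+ k) ^- n.-1]. The terms are thus geometric of
ratio [2 `^ s / 2 ^+ n.-1], and this is less than 1 exactly when [p < n]. *)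
Lemma potential_far_le (p Cphi r : R) (D : set (Rn R n)) :
  1 <= p -> p < n%:R ->
  (forall t1 t2, 0 < t1 -> t1 <= t2 -> phi t1 / t1 <= Cphi * (phi t2 / t2)) ->
  (Lnorm mu p%:E (EFin \o f) <= 1)%E ->
  0 < r -> measurable D -> (forall y, D y -> r <= enorm (x - y)) ->
  (\int[mu]_(y in D) (`|f y| / phi (enorm (x - y)) ^+ n.-1)%:E <=
     (far_const n p Cphi
       * (phi r ^- n.-1 * r `^ (n%:R * (1 - p^-1))))%:E)%E.
Proof.
move=> p1 pn phidiv fp r0 mD Dr; rewrite /far_const; set s := n%:R * (1 - p^-1).
apply: (le_trans (riesz_far (measurable_enormB x) (fun y => enorm_ge0 _) rho0
  w_ge0 w_noninc mf r0 mD Dr (@measurable_kernel_weight D))).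
have lev0 k : 0 < 2 ^+ k * r by rewrite mulr_gt0// exprn_gt0.
have p0 : 0 < p by exact: lt_le_trans p1.
have n1 : n%:R = n.-1%:R + 1 :> R by rewrite natr1 prednK// (leq_trans _ n_gt1).
have s_lt : s < n.-1%:R.
  (* [n.-1 - s = n / p - 1] *)
  have : 1 < n%:R / p by rewrite ltr_pdivlMr ?mul1r.
  by rewrite /s mulrBr mulr1 [X in X - _ < _]n1; lra.
pose q : R := 2 `^ s / 2 ^+ n.-1.
have q0 : 0 < q by rewrite divr_gt0 ?exprn_gt0 ?powR_gt0.
have q1 : q < 1.
  rewrite ltr_pdivrMr ?exprn_gt0// mul1r -powR_mulrn//.
  by rewrite /powR pnatr_eq0/= ltr_expR ltr_pM2r// ln_gt0// ltr1n.
(* The almost monotonicity with [t1 = t2] forces [1 <= Cphi]. *)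
have C0 : 0 <= Cphi.
  have := phidiv r r r0 (lexx r); rewrite -{1}(mul1r (_ / _)) ler_pM2r; last first.
    by rewrite divr_gt0// incr_gt0.
  exact: le_trans.
set P := phi r ^- n.-1 * r `^ s.
have P0 : 0 <= P by rewrite mulr_ge0 ?powR_ge0// w_ge0// ltW.
pose c := 2 * 4 `^ s * Cphi ^+ n.-1 * P.
have c0 : 0 <= c.
  by rewrite mulr_ge0// mulr_ge0 ?exprn_ge0// mulr_ge0 ?powR_ge0.
rewrite [leRHS](_ : _ = (c / (1 - q))%:E); last by rewrite /c mulrAC.
apply: le_trans (nneseries_geometric_le c0 q0 q1).
apply: lee_nneseries => [k _ _|k _].
  by rewrite mule_ge0 ?lee_fin ?w_ge0 ?(ltW (lev0 _))// integral_ge0.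
apply: (@le_trans _ _ ((w (2 ^+ k * r))%:E *
    (2 * ((2 * (2 ^+ k.+1 * r)) ^+ n) `^ (1 - p^-1))%:E)%E).
  apply: lee_wpmul2l; first by rewrite lee_fin w_ge0// ltW.
  apply: integral_le_Lnorm => //.
  - by rewrite exprn_gt0// mulr_gt0.
  - exact: measurable_eball.
  - exact: eball_volume_le.
rewrite -EFinM lee_fin.
have -> : ((2 * (2 ^+ k.+1 * r)) ^+ n) `^ (1 - p^-1) =
    4 `^ s * (2 `^ s) ^+ k * r `^ s.
  have -> : 2 * (2 ^+ k.+1 * r) = 4 * 2 ^+ k * r.
    by rewrite exprS !mulrA -natrM.
  have e0 : 0 <= 4 * 2 ^+ k :> R by rewrite mulr_ge0// exprn_ge0.
  rewrite -powR_mulrn ?mulr_ge0 ?(ltW r0)// -powRrM -/s.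
  rewrite (powRM s e0 (ltW r0)) powRM ?exprn_ge0//.
  congr (_ * _ * _).
  by rewrite -(powR_mulrn k (powR_ge0 2 s)) -powR_mulrn// -!powRrM (mulrC s).
have wle : w (2 ^+ k * r) <= Cphi ^+ n.-1 / (2 ^+ k) ^+ n.-1 * phi r ^- n.-1.
  have := phidiv r (2 ^+ k * r) r0; rewrite ler_peMl ?exprn_ege1 ?ler1n ?(ltW r0)//.
  move=> /(_ isT) le1.
  have {}le1 : (phi (2 ^+ k * r))^-1 <= Cphi / 2 ^+ k / phi r.
    rewrite -[leLHS]div1r ler_pdivrMr ?incr_gt0//.
    rewrite mulrAC ler_pdivlMr ?incr_gt0// mul1r.
    move: le1; rewrite ler_pdivrMr// => /le_trans; apply.
    rewrite le_eqVlt; apply/orP; left; apply/eqP.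
    by field; rewrite gt_eqF//= gt_eqF// exprn_gt0.
  rewrite /w -!exprVn -!exprMn lerXn2r// ?nnegrE.
    by rewrite invr_ge0 phi_ge0// ltW.
    by rewrite !mulr_ge0// ?invr_ge0 ?exprn_ge0 ?phi_ge0 ?(ltW r0).
  by rewrite exprVn.
apply: (le_trans (ler_wpM2r _ wle)).
  by rewrite !mulr_ge0// ?exprn_ge0 ?powR_ge0.
rewrite le_eqVlt; apply/orP; left; apply/eqP.
rewrite /c /P /q exprMn exprVn -!exprM (mulnC k).
by field; rewrite !expf_neq0 ?pnatr_eq0// gt_eqF// incr_gt0.
Qed.

End potential_estimates.

(** Hedberg's splitting at the radius [r], which is still free. *)
Lemma potential_le (R : realType) (n : nat) (phi h : R -> R) (p Cphi : R)
    (f : 'rV[R]_n -> R) (x : 'rV[R]_n) (t r : R) (G : set (Rn R n)) :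
  (2 <= n)%N -> 1 <= p -> p < n%:R ->
  (forall t, 0 <= t -> 0 <= phi t) ->
  {in `[0, +oo[ &, {homo phi : s t / s < t}} ->
  (forall t1 t2, 0 < t1 -> t1 <= t2 -> phi t1 / t1 <= Cphi * (phi t2 / t2)) ->
  (forall r, 0 < r -> (\sum_(1 <= k <oo)
     ((2 ^- k * r) ^+ n / phi (r * 2 ^- k) ^+ n.-1)%:E <= (h r)%:E)%E) ->
  measurable_fun [set: Rn R n] f ->
  (Lnorm (lebesgue_rV R n) p%:E (EFin \o f) <= 1)%E ->
  measurable G -> 0 < r -> 0 <= t -> (maximal f x <= t%:E)%E ->
  (\int[lebesgue_rV R n]_(y in G) (`|f y| / phi (enorm (x - y)) ^+ n.-1)%:E <=
    (4 ^+ n * (h r * t) +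
     far_const n p Cphi * (phi r ^- n.-1 * r `^ (n%:R * (1 - p^-1))))%:E)%E.
Proof.
move=> n2 p1 pn phi0 phii phid hs mf fp mG r0 t0 Mt.
have mB := measurable_eball x r.
rewrite -{1}(setUIDK G (eball x r)).
rewrite ge0_integral_setU.
- rewrite EFinD; apply: leeD.
    by apply: potential_near_le => //; exact: measurableI.
  apply: potential_far_le => //; first exact: measurableD.
  by move=> y [_ /negP]; rewrite -leNgt.
- exact: measurableI.
- exact: measurableD.
- apply/measurable_EFinP/measurable_funM; last exact: measurable_kernel_weight.
  by apply: measurable_funS (measurableT_comp _ mf) => //.
- by move=> y _; rewrite lee_fin divr_ge0// exprn_ge0// phi0// enorm_ge0.
- by apply/disj_setPS => y [[_ yB] [_ /(_ yB)]].
Qed.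

(** If the maximal function vanishes at [x], the near estimate gives 0 on every
ball around [x], and these balls exhaust the space. *)
Lemma potential_eq0 (R : realType) (n : nat) (phi h : R -> R)
    (f : 'rV[R]_n -> R) (x : 'rV[R]_n) (G : set (Rn R n)) :
  (2 <= n)%N ->
  (forall t, 0 <= t -> 0 <= phi t) ->
  {in `[0, +oo[ &, {homo phi : s t / s < t}} ->
  (forall r, 0 < r -> (\sum_(1 <= k <oo)
     ((2 ^- k * r) ^+ n / phi (r * 2 ^- k) ^+ n.-1)%:E <= (h r)%:E)%E) ->
  measurable_fun [set: Rn R n] f -> measurable G -> maximal f x = 0%E ->
  (\int[lebesgue_rV R n]_(y in G) (`|f y| / phi (enorm (x - y)) ^+ n.-1)%:E = 0)%E.
Proof.
move=> n2 phi0 phii hs mf mG M0.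
have F0 y : (0 <= (`|f y| / phi (enorm (x - y)) ^+ n.-1)%:E)%E.
  by rewrite lee_fin divr_ge0// exprn_ge0// phi0// enorm_ge0.
have mF : measurable_fun [set: Rn R n]
    (fun y => (`|f y| / phi (enorm (x - y)) ^+ n.-1)%:E).
  apply/measurable_EFinP/measurable_funM; last exact: measurable_kernel_weight.
  exact: measurableT_comp.
apply/eqP; rewrite eq_le integral_ge0 ?andbT//.
apply: (le_trans (@integral_le_series_cover _ _ _ (lebesgue_rV R n) G set0
    (fun k => eball x k.+1%:R) (fun=> 1) _ _ mG measurable0 (measure0 _)
    (fun k => measurable_eball _ _) (fun=> ler01)
    (measurable_funS measurableT (@subsetT _ _) mF) (fun y _ => F0 y) mF F0 _)).
  move=> y _ _; exists (Num.truncn (enorm (x - y))); last by rewrite mul1e.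
  exact: truncnS_gt.
rewrite (eq_eseriesr (g := fun=> 0%E)) ?eseries0// => k _; rewrite mul1e.
apply/eqP; rewrite eq_le integral_ge0 ?andbT//.
have k0 : 0 < k.+1%:R :> R by [].
apply: (le_trans (potential_near_le n2 phi0 phii mf hs k0 (lexx 0) _
  (measurable_eball _ _) (@subset_refl _ _))); first by rewrite M0.
by rewrite !mulr0.
Qed.

(** * Orlicz functions and the main estimate *)

Lemma delta2_iter (R : realType) (H : R -> R) (K : R) :
  0 <= K -> delta2 H K -> forall m t, 0 < t -> H (2 ^+ m * t) <= K ^+ m * H t.
Proof.
move=> K0 HK; elim=> [|m IHm] t t0; first by rewrite !expr0 !mul1r.
rewrite exprS -mulrA (le_trans (HK _ _)) ?mulr_gt0 ?exprn_gt0//.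
by rewrite exprS -mulrA ler_wpM2l// IHm.
Qed.

(** As [H t / t] increases, [H t <= t * H 1] for [t < 1]; since [H] is
increasing, [H 0 <= t * H 1] for arbitrarily small [t]. *)
Lemma orlicz0 (R : realType) (H : R -> R) : orlicz H -> H 0 = 0.
Proof.
move=> HO; apply/eqP; rewrite eq_le (orlicz_ge0 HO)// andbT.
have H1 : 0 <= H 1 by exact: (orlicz_ge0 HO).
apply/ler_addgt0Pr => e e0; rewrite add0r.
pose t := Num.min (2^-1) (e / (H 1 + 1)).
have t0 : 0 < t by rewrite lt_min invr_gt0 ltr0n divr_gt0// ltr_wpDl.
have t1 : t < 1 by rewrite gt_min invf_lt1// ltr1n.
apply: (@le_trans _ _ (H t)).
  by apply/ltW/(orlicz_increasing HO); rewrite ?in_itv/= ?lexx ?(ltW t0).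
have := ltW (orlicz_div_increasing HO t0 t1).
rewrite divr1 ler_pdivrMr// => /le_trans; apply.
have H11 : 0 < H 1 + 1 by rewrite ltr_wpDl.
apply: (@le_trans _ _ ((H 1 + 1) * t)); first by rewrite ler_wpM2r ?lerDl// ltW.
by rewrite mulrC -ler_pdivlMr// ge_min lexx orbT.
Qed.

Lemma delta2_orlicz_ge0 (R : realType) (H : R -> R) (K : R) :
  orlicz H -> delta2 H K -> 0 <= K.
Proof.
move=> HO HK; have H1 : 0 < H 1.
  apply: (le_lt_trans (orlicz_ge0 HO (lexx 0))).
  by apply: (orlicz_increasing HO) => //; rewrite in_itv/= ?lexx ?ler01.
have := HK 1 ltr01; rewrite mulr1 => HK1.
by rewrite -(pmulr_lge0 _ H1) (le_trans _ HK1)// (orlicz_ge0 HO).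
Qed.

Theorem theorem1p3 (R : realType) (n : nat) (p Cphi CH CD : R)
    (n_ge2 : (2 <= n)%N) (p_ge1 : 1 <= p) (p_ltn : p < n%:R) :
  exists C : R,
  forall (phi : R -> R)
    (phi_ge0 : forall t, 0 <= t -> 0 <= phi t)
    (phi_cont : {within `[0, +oo[, continuous phi})
    (phi_incr : {in `[0, +oo[ &, {homo phi : s t / s < t}})
    (phi_div : forall t1 t2, 0 < t1 -> t1 <= t2 ->
       phi t1 / t1 <= Cphi * (phi t2 / t2))
    (h : R -> R)
    (h_ge0 : forall t, 0 <= t -> 0 <= h t)
    (h_cont : {within `[0, +oo[, continuous h})
    (h_sum : forall t, 0 < t ->
       (\sum_(1 <= k <oo)
          ((2 ^- k * t) ^+ n / phi (t * 2 ^- k) ^+ n.-1)%:E <= (h t)%:E)%E)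
    (delta : R -> R)
    (delta_gt0 : forall t, 0 < t -> 0 < delta t)
    (delta_cont : {within `]0, +oo[, continuous delta})
    (H : R -> R) (H_orlicz : orlicz H) (H_delta2 : delta2 H CD)
    (H_bound : forall t, 0 < t ->
       H (h (delta t) * t +
          phi (delta t) ^- n.-1 * delta t `^ (n%:R * (1 - p^-1)))
       <= CH * t `^ p)
    (G : set 'rV[R]_n) (G_open : open G)
    (f : 'rV[R]_n -> R)
    (f_meas : measurable_fun [set: Rn R n] f)
    (f_norm : (Lnorm (lebesgue_rV R n) p%:E (EFin \o f) <= 1)%E)
    (x : 'rV[R]_n),
  (er_map H (\int[lebesgue_rV R n]_(y in G)
               (`|f y| / phi (enorm (x - y)) ^+ n.-1)%:E)
   <= C%:E * maximal f x `^ p)%E.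
Proof.
(* [2 ^+ m] absorbs the constants of both parts of [potential_le], and the
   doubling condition takes it out of [H] at the price of [CD ^+ m]. The
   constant must be positive for the case of an infinite maximal function. *)
have [m mc] := exists_expr2_gt (4 ^+ n + `|far_const n p Cphi|).
exists (`|CD ^+ m * CH| + 1).
move=> phi phi_ge0 phi_cont phi_incr phi_div h h_ge0 h_cont h_sum delta delta_gt0
  delta_cont H HO HD HB G oG f mf fp x.
have CD0 := delta2_orlicz_ge0 HO HD.
have mG := open_measurable_Rn oG.
have C0 : 0 < `|CD ^+ m * CH| + 1 :> R by rewrite ltr_wpDl.
have p0 : 0 < p by exact: lt_le_trans p_ge1.
set I := (X in er_map H X).
have I0 : (0 <= I)%E.
  by apply: integral_ge0 => y _; rewrite lee_fin divr_ge0// exprn_ge0// phi_ge0// enorm_ge0.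
have M0 := maximal_ge0 f x.
case ME : (maximal f x) M0 => [t| |]// M0; last first.
  by rewrite poweRyr ?gt_eqF// gt0_muley ?leey// lte_fin.
rewrite poweR_EFin -EFinM.
have Ile r : 0 < r -> (I <= (4 ^+ n * (h r * t) +
     far_const n p Cphi * (phi r ^- n.-1 * r `^ (n%:R * (1 - p^-1))))%:E)%E.
  by move=> r0; apply: potential_le => //; rewrite ME.
move: M0; rewrite lee_fin le_eqVlt => /predU1P[t0|t0]; last first.
  (* The radius [delta t] is the one for which [HB] controls both parts. *)
  have r0 : 0 < delta t := delta_gt0 _ t0.
  have := HB _ t0; set S1 := h _ * t; set S2 := phi _ ^- _ * _ => HS.
  have S10 : 0 <= S1 by rewrite mulr_ge0 ?h_ge0// ltW.
  have S20 : 0 < S2 by rewrite mulr_gt0 ?powR_gt0// invr_gt0 exprn_gt0// incr_gt0.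
  have S0 : 0 < S1 + S2 by rewrite ltr_wpDl.
  have IS : (I <= (2 ^+ m * (S1 + S2))%:E)%E.
    apply: (le_trans (Ile _ r0)); rewrite lee_fin -/S1 -/S2 mulrDr lerD//.
      by rewrite ler_wpM2r// (le_trans _ (ltW mc))// lerDl.
    rewrite ler_wpM2r ?(ltW S20)// (le_trans (ler_norm _))//.
    by rewrite (le_trans _ (ltW mc))// lerDr exprn_ge0.
  have Ifin : I \is a fin_num by rewrite ge0_fin_numE// (le_lt_trans IS) ?ltry.
  move: I0 IS; rewrite -(fineK Ifin) /= !lee_fin => I0 IS.
  apply: (@le_trans _ _ (H (2 ^+ m * (S1 + S2)))).
    move: IS; rewrite le_eqVlt => /predU1P[->//|IS]; apply/ltW.
    by apply: (orlicz_increasing HO) => //; rewrite in_itv/= andbT// (le_trans I0)// ltW.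
  apply: (le_trans (delta2_iter CD0 HD m S0)).
  apply: (@le_trans _ _ (CD ^+ m * (CH * t `^ p))).
    by rewrite ler_wpM2l// exprn_ge0.
  rewrite mulrA ler_wpM2r ?powR_ge0//.
  by rewrite (le_trans (ler_norm _))// lerDl.
have -> : I = 0%E.
  by apply: (potential_eq0 _ _ _ h_sum) => //; rewrite ME -t0.
by rewrite /= (orlicz0 HO) lee_fin mulr_ge0 ?powR_ge0// ltW.
Qed.
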